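(* Let $X$ be a real reflexive Banach space and let $A, B : X \rightrightarrows X^*$ be maximal monotone operators such that ${}^{ic}\left[\operatorname{conv}(\operatorname{gra} A - \operatorname{gra}(-B))\right] \neq \varnothing$. Then $${}^{ic}\left[\operatorname{gra} A - \operatorname{gra}(-B)\right] = {}^{ic}\left[\operatorname{conv}(\operatorname{gra} A - \operatorname{gra}(-B))\right] = {}^{ic}\left[\operatorname{dom} F_A - \operatorname{dom} \widehat{F_B}\right].$$ Moreover, if $F_1, F_2$ are representatives of $A, B$, respectively, then $${}^{ic}\left[\operatorname{dom} F_1 - \operatorname{dom} \widehat{F_2}\right] = {}^{ic}\left[\operatorname{conv}(\operatorname{gra} A - \operatorname{gra}(-B))\right] = {}^{ic}\left[\operatorname{dom} F_A - \operatorname{dom} \widehat{F_B}\right].$$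
   Context: $X$ is a real reflexive Banach space with dual $X^*$ and duality pairing $\langle\cdot,\cdot\rangle$. For a set-valued operator $A : X \rightrightarrows X^*$, $\operatorname{gra} A := \{(x,x^* ) \in X\times X^* \mid x^* \in Ax\}$. $A$ is monotone if $\langle x-y, x^*-y^*\rangle \ge 0$ for all $(x,x^* ),(y,y^* )\in\operatorname{gra} A$, and maximal monotone if it is monotone and has no proper monotone extension (in the sense of inclusion of graphs). $-B$ is the operator $x\mapsto -Bx$, so $\operatorname{gra}(-B)=\{(y,-y^* ) \mid (y,y^* )\in\operatorname{gra} B\}$. The difference of sets is the Minkowski difference $C-D=\{c-d\mid c\in C, d\in D\}$. The Fitzpatrick function of $A$ is $F_A : X\times X^* \to \,]-\infty,+\infty]$, $F_A(x,x^* ) := \sup_{(a,a^* )\in\operatorname{gra} A}\left(\langle x,a^*\rangle + \langle a,x^*\rangle - \langle a,a^*\rangle\right)$. For a function $f$ with values in $]-\infty,+\infty]$, $\operatorname{dom} f := \{z \mid f(z)<+\infty\}$. For $F : X\times X^*\to\,]-\infty,+\infty]$, define $\widehat{F}(x,x^* ) := F(x,-x^* )$, and let $F^*$ on $X^*\times X$ be its Fenchel conjugate, $F^*(x^*,x)=\sup_{(y,y^* )\in X\times X^*}\left(\langle y,x^*\rangle+\langle x,y^*\rangle-F(y,y^* )\right)$ (using reflexivity). $F$ is a representative of a maximal monotone operator $A$ if $F$ is lower semicontinuous and convex, $F(x,x^* )\ge\langle x,x^*\rangle$ and $F^*(x^*,x)\ge\langle x,x^*\rangle$ for all $(x,x^*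 )\in X\times X^*$, and $\operatorname{gra} A=\{(x,x^* )\mid F(x,x^* )=\langle x,x^*\rangle\}$. For a subset $D$ of a Banach space (here $X\times X^*$), $\operatorname{conv} D$ and $\operatorname{aff} D$ denote the convex hull and affine hull. The intrinsic core (relative algebraic interior) of $D$ is ${}^{i}D := \{a\in D \mid \forall x\in\operatorname{aff}(D-D),\ \exists \delta>0,\ \forall\lambda\in[0,\delta]:\ a+\lambda x\in D\}$. Define ${}^{ic}D := {}^{i}D$ if $\operatorname{aff} D$ is closed, and ${}^{ic}D:=\varnothing$ otherwise. *)

(* Defs.v *)
From HB Require Import structures.
From mathcomp Require Import all_boot all_order all_algebra.
From mathcomp Require Import interval_inference.
From mathcomp Require Import all_classical all_reals all_analysis.

Set Implicit Arguments.
Unset Strict Implicit.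
Unset Printing Implicit Defensive.

Import Order.TTheory GRing.Theory Num.Theory.
Import numFieldNormedType.Exports.

Local Open Scope classical_set_scope.
Local Open Scope ring_scope.

Section dual.
Context {R : realType}.

Definition dual_pred (X : normedModType R) : {pred (X -> R^o)} :=
  mem [set f : X -> R^o | linear f /\ continuous f].

Arguments dual_pred : clear implicits.

Record dual (X : normedModType R) : Type := Dual {
  dual_fun :> X -> R^o ;
  _ : dual_fun \in dual_pred X }.

Context {X : normedModType R}.

HB.instance Definition _ := [isSub for @dual_fun X].
HB.instance Definition _ := [Choice of dual X by <:].

Lemma dual_linear (f : dual X) : linear f.
Proof. by have /set_mem[] := valP f. Qed.

Lemma dual_continuous (f : dual X) : continuous f.
Proof. by have /set_mem[] := valP f. Qed.

HB.instance Definition _ (f : dual X) :=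
  GRing.isLinear.Build R X R^o _ (dual_fun f) (@dual_linear f).

Lemma dual_submod_closed : submod_closed (dual_pred X).
Proof.
split=> [|a f g /set_mem[lf cf] /set_mem[lg cg]]; apply: mem_set; split.
- by move=> a x y; rewrite /= scaler0 addr0.
- exact: cst_continuous.
- move=> b x y; rewrite !fctE lf lg !scalerDr !scalerA (mulrC a b).
  by rewrite -!addrA; congr (_ + _); rewrite addrCA.
- move=> x; apply: cvgD; last exact: cg.
  by apply: cvgZr; exact: cf.
Qed.

HB.instance Definition _ := GRing.isSubmodClosed.Build R (X -> R^o)
  (dual_pred X) dual_submod_closed.

HB.instance Definition _ := [SubChoice_isSubLmodule of dual X by <:].

Definition dual_norm (f : dual X) : R :=
  sup [set `|f x| | x in [set x : X | `|x| <= 1]].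

Lemma dual_norm_has_sup (f : dual X) :
  has_sup [set `|f x| | x in [set x : X | `|x| <= 1]].
Proof.
split; first by exists `|f 0|, 0 => //=; rewrite normr0 ler01.
have /bounded_funP/(_ 1)[M fM] : bounded_near f (nbhs (0 : X)).
  by apply: continuous_linear_bounded; exact: dual_continuous.
by exists M => _ [x /= x1 <-]; exact: fM.
Qed.

Lemma dual_norm_ub (f : dual X) (x : X) : `|x| <= 1 -> `|f x| <= dual_norm f.
Proof.
by move=> x1; apply: sup_upper_bound; [exact: dual_norm_has_sup|exists x].
Qed.

Lemma dual_norm_le (f : dual X) (M : R) :
  (forall x : X, `|x| <= 1 -> `|f x| <= M) -> dual_norm f <= M.
Proof.
move=> fM; apply: ge_sup; first by have [] := dual_norm_has_sup f.
by move=> _ [x /= x1 <-]; exact: fM.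
Qed.

Lemma dual_norm_ge0 (f : dual X) : 0 <= dual_norm f.
Proof.
by apply: le_trans (dual_norm_ub f (x := 0) _) => //; rewrite normr0 ler01.
Qed.

Lemma dual_normD (f g : dual X) : dual_norm (f + g) <= dual_norm f + dual_norm g.
Proof.
apply: dual_norm_le => x x1; rewrite (le_trans (ler_normD _ _))//.
by rewrite lerD// dual_norm_ub.
Qed.

Lemma dual_norm_leZ (a : R) (f : dual X) :
  dual_norm (a *: f) <= `|a| * dual_norm f.
Proof.
apply: dual_norm_le => x x1; rewrite [X in `|X|](_ : _ = a * f x)//.
by rewrite normrM ler_wpM2l// dual_norm_ub.
Qed.

Lemma dual_normZ (a : R) (f : dual X) : dual_norm (a *: f) = `|a| * dual_norm f.
Proof.
apply/eqP; rewrite eq_le dual_norm_leZ/=.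
have [->|a0] := eqVneq a 0; first by rewrite normr0 mul0r dual_norm_ge0.
rewrite -ler_pdivlMl ?normr_gt0// -normfV.
by rewrite -{1}(scale1r f) -(mulVf a0) -scalerA dual_norm_leZ.
Qed.

Lemma dual_norm_eq0 (f : dual X) : dual_norm f = 0 -> f = 0.
Proof.
move=> f0; apply/val_inj/funext => x /=.
have [->|x0] := eqVneq x 0; first by rewrite linear0.
have nx0 : `|x| != 0 by rewrite normr_eq0.
have : `|f (`|x|^-1 *: x)| <= 0.
  by rewrite -f0; apply: dual_norm_ub; rewrite normrZ normfV normr_id mulVf.
rewrite normr_le0 linearZ /= => /eqP/(congr1 (fun r => `|x| * r)).
by rewrite mulr0 mulrA mulfV// mul1r.
Qed.

HB.instance Definition _ :=
  @Lmodule_isNormed.Build R (dual X) dual_norm dual_normD dual_normZ dual_norm_eq0.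

End dual.
Arguments dual {R} X.


Definition pairing {R : realType} {X : normedModType R} (x : X) (xs : dual X) : R
  := xs x.

Definition reflexive_space {R : realType} (X : normedModType R) : Prop :=
  forall phi : dual (dual X), exists x : X, forall xs : dual X,
    phi xs = pairing x xs.

Section sets.
Context {R : realType}.

Definition minkowski_diff {V : zmodType} (C D : set V) : set V :=
  [set c - d | c in C & d in D].

Definition affine_set {V : lmodType R} (M : set V) : Prop :=
  forall (x y : V) (t : R), M x -> M y -> M (t *: x + (1 - t) *: y).

Definition aff_hull {V : lmodType R} (D : set V) : set V :=
  smallest (@affine_set V) D.

Definition conv_hull {V : lmodType R} (D : set V) : set V :=
  smallest (@convex_set R V) D.

Definition intrinsic_core {V : lmodType R} (D : set V) : set V :=
  [set a | D a /\ forall x, aff_hull (minkowski_diff D D) x ->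
    exists2 delta : R, 0 < delta &
      forall l : R, 0 <= l <= delta -> D (a + l *: x)].

Definition ic {V : normedModType R} (D : set V) : set V :=
  if `[< closed (aff_hull D) >] then intrinsic_core D else set0.

End sets.

Section functions.
Context {R : realType}.
Local Open Scope ereal_scope.

Definition edom {T : Type} (f : T -> \bar R) : set T := [set z | f z < +oo].

(* Endpoints t = 0, 1 add nothing; for 0 < t < 1 no product 0 * +oo occurs. *)
Definition convex_efun {V : lmodType R} (f : V -> \bar R) : Prop :=
  forall (x y : V) (t : R), (0 < t < 1)%R ->
    f (t *: x + (1 - t) *: y)%R <= t%:E * f x + (1 - t)%:E * f y.

Context {X : normedModType R}.

Definition hat (F : X * dual X -> \bar R) : X * dual X -> \bar R :=
  fun z => F (z.1, - z.2)%R.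

Definition fenchel_conj (F : X * dual X -> \bar R) : dual X * X -> \bar R :=
  fun w => ereal_sup
    [set (pairing z.1 w.1 + pairing w.2 z.2)%:E - F z | z in setT].

End functions.

Section operators.
Context {R : realType} {X : normedModType R}.

Definition operator : Type := X -> set (dual X).

Implicit Types A B : operator.

Definition gra A : set (X * dual X) := [set z | A z.1 z.2].

Definition opp_operator A : operator := fun x => [set - xs | xs in A x].

Definition monotone A : Prop := forall z w, gra A z -> gra A w ->
  0 <= pairing (z.1 - w.1) (z.2 - w.2).

Definition maximal_monotone A : Prop := monotone A /\
  forall B, monotone B -> gra A `<=` gra B -> gra B = gra A.

Definition fitzpatrick A : X * dual X -> \bar R := fun z => ereal_sup
  [set (pairing z.1 a.2 + pairing a.1 z.2 - pairing a.1 a.2)%:E | a in gra A].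

Definition representative A (F : X * dual X -> \bar R) : Prop :=
  [/\ forall z, (-oo < F z)%E,
      lower_semicontinuous F,
      convex_efun F,
      forall x xs, ((pairing x xs)%:E <= F (x, xs))%E /\
                   ((pairing x xs)%:E <= fenchel_conj F (xs, x))%E &
      gra A = [set z | F z = (pairing z.1 z.2)%:E]].

End operators.
Arguments operator {R} X.

(* Main.v *)
Require Import Defs.
From mathcomp Require Import all_boot all_order all_algebra.
From mathcomp Require Import ring lra.
From mathcomp Require Import all_classical all_reals all_analysis.

Set Implicit Arguments.
Unset Strict Implicit.
Unset Printing Implicit Defensive.

Import Order.TTheory GRing.Theory Num.Theory.
Import numFieldNormedType.Exports.

Local Open Scope classical_set_scope.
Local Open Scope ring_scope.

(** Write [Z] for [X * X^*] with the symmetric bilinear form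
    [beta (x, xs) (y, ys) = <x, ys> + <y, xs>] and its quadratic form
    [q (x, xs) = <x, xs>].  By reflexivity every continuous linear functional on
    [Z] is [beta v] for some [v]: the space is self-dual for [beta].  Monotonicity
    of [A] says that [q] is nonnegative on differences of points of [gra A], and
    passing from [B] to [-B] amounts to replacing [beta] by [- beta].  The problem
    thus becomes symmetric: [A] is a maximal positive set for [beta], [-B] one for
    [- beta], and the Fitzpatrick function of [A] is the supremum of the affine
    functions [beta z a - q a], [a] in [A].

    Let [G] be the difference of the two graphs and [D] the difference of the two
    Fitzpatrick domains, so that [G] and [conv G] lie in the convex set [D].
    Everything follows from two facts.

    (1) The intrinsic core of [D] is contained in [G] when [aff D] is closed
    ([intrinsic_core_fitz_dom_diff]).  After a translation it suffices to show
    that the two sets meet when [0] is in the intrinsic core of [D].  Sublevel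
    sets of the Fitzpatrick functions are weakly closed, hence the sets of
    differences of points of bounded norm and bounded Fitzpatrick value are closed
    ([closed_sublevel_diff]); by Baire's theorem one of them contains a ball of
    [aff D] ([sublevel_diff_absorbs]).  As the Fitzpatrick functions dominate [q]
    and [- q], their sum is nonnegative on the diagonal, and the ball turns this
    into a lower bound that is Lipschitz in the distance to the diagonal
    ([fitz_sum_lipschitz]).  The Hahn-Banach theorem then yields [v] with
    [beta (a - b) v <= q a - q b], that is [q (b - v) <= q (a - v)], for all [a] in
    [A] and [b] in [-B] ([separating_vector]).  By maximality such a [v] lies in
    both sets ([maximal_positive_meet]).

    (2) A closed affine set that contains [G] contains [D]
    ([fitz_dom_diff_sub_affine]).  It is enough to treat a hyperplane
    [beta _ v = c].  Then [beta _ v] is constant on [A] and on [-B]; maximality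
    forces [q v = 0] and invariance of both sets under translation along [v], so
    the Fitzpatrick functions are finite only where [beta _ v] has the same
    constant values.

    If the intrinsic core of [conv G] is nonempty and [aff (conv G)] closed, then
    (2) gives [aff D = aff (conv G)], hence [D] has a nonempty intrinsic core too,
    and (1) puts this core in [G].  A set squeezed between the intrinsic core of a
    convex set and this convex set has the same affine hull and the same intrinsic
    core ([intrinsic_core_sandwich]); this applies to [G], to [conv G] and to every
    [dom F1 - dom (hat F2)], because the graph of [A] lies in [dom F1] and [F1]
    dominates the Fitzpatrick function of [A]. *)

(** * The Hahn-Banach theorem for sublinear functionals *)
Section hahn_banach.
Context {R : realType} {V : lmodType R}.
Implicit Types (p : V -> R) (x y : V).

Definition sublinear p : Prop :=
  (forall x y, p (x + y) <= p x + p y) /\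
  (forall t x, 0 < t -> p (t *: x) = t * p x).

Definition linear_form (phi : V -> R) : Prop :=
  forall a x y, phi (a *: x + y) = a * phi x + phi y.

Lemma linear_form0 phi : linear_form phi -> phi 0 = 0.
Proof. by move=> lphi; have := lphi 1 0 0; rewrite scaler0 addr0; lra. Qed.

Lemma linear_formN phi x : linear_form phi -> phi (- x) = - phi x.
Proof.
by move=> lphi; have := lphi (-1) x 0; rewrite addr0 linear_form0// scaleN1r; lra.
Qed.

Lemma sublinear0 p : sublinear p -> p 0 = 0.
Proof. by move=> [_ /(_ 2 0)]; rewrite scaler0 => /(_ (ltr0Sn _ _)); lra. Qed.

Lemma sublinearZ p t x : sublinear p -> 0 <= t -> p (t *: x) = t * p x.
Proof.
move=> ps; rewrite le_eqVlt => /predU1P[<-|]; last exact: ps.2.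
by rewrite scale0r mul0r sublinear0.
Qed.

Lemma sublinear_ge p x : sublinear p -> - p (- x) <= p x.
Proof.
by move=> ps; have := ps.1 x (- x); rewrite subrr sublinear0//; lra.
Qed.

(** All sublinear functionals below are lower boundaries of convex cones of
    [V * R], presented here as relations; homogeneity is only asked for positive
    factors, so that the cone may omit its apex. *)
Lemma sublinear_inf (E : V -> R -> Prop) :
  (forall x y r s, E x r -> E y s -> E (x + y) (r + s)) ->
  (forall t x r, 0 < t -> E x r -> E (t *: x) (t * r)) ->
  (forall x, exists r, E x r) ->
  (forall x, exists m, forall r, E x r -> m <= r) ->
  sublinear (fun x => inf [set r | E x r]).
Proof.
move=> ED EZ Ene Elb.
have ge (x : V) (r : R) : E x r -> inf [set r | E x r] <= r.
  by move=> Exr; apply: ge_inf => //; have [m] := Elb x; exists m.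
have le (x : V) (m : R) : (forall r, E x r -> m <= r) -> m <= inf [set r | E x r].
  by move=> Em; apply: lb_le_inf => //; have [r] := Ene x; exists r.
split=> [x y|t x] /=.
  rewrite -lerBlDr; apply: (le x) => r Er; rewrite lerBlDr -lerBlDl.
  by apply: (le y) => s Es; rewrite lerBlDl; exact/ge/ED.
have ZE c y : 0 < c ->
    inf [set r | E (c *: y) r] <= c * inf [set r | E y r].
  move=> c0; rewrite -ler_pdivrMl//; apply: le => r Er.
  by rewrite ler_pdivrMl//; apply: ge; exact: EZ.
move=> t0; apply/eqP; rewrite eq_le ZE//=.
rewrite -ler_pdivlMl//; apply: le_trans (ZE _ _ _); last by rewrite invr_gt0.
by rewrite scalerA mulVf ?gt_eqF// scale1r.
Qed.

(** Zorn's lemma: the pointwise infimum of a chain of sublinear functionals is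
    sublinear, and it is finite because all of them dominate [- p (- x)]. *)
Lemma exists_minimal_sublinear p : sublinear p ->
  exists2 s, sublinear s /\ (forall x, s x <= p x) &
    forall s', sublinear s' -> (forall x, s' x <= s x) -> forall x, s x <= s' x.
Proof.
move=> ps; pose T := {s : V -> R | sublinear s /\ forall x, s x <= p x}.
have p0 : sublinear p /\ forall x, p x <= p x by [].
have [|||s smin] := @ZL_preorder T (exist _ p p0)
    (fun s s' => `[< forall x, sval s' x <= sval s x >]).
- by move=> s; apply/asboolP.
- move=> r s t /asboolP rs /asboolP st; apply/asboolP => x.
  exact: le_trans (st x) (rs x).
- move=> A Atot; have [[s0 As0]|Ane] := pselect (A !=set0); last first.
    by exists (exist _ p p0) => s As; exfalso; apply: Ane; exists s.
  pose E x r := exists2 s : T, A s & sval s x <= r.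
  have Elb x r : E x r -> - p (- x) <= r.
    move=> [[s [ss sp]] _ /= sr].
    by have := sublinear_ge x ss; have := sp (- x); lra.
  have Ess : sublinear (fun x => inf [set r | E x r]).
    apply: sublinear_inf => [x y r r' [s As sr] [s' As' sr']|t x r t0 [s As sr]|x|x].
    - have [/asboolP ss'|/asboolP ss'] := Atot _ _ As As'.
        exists s' => //; have := (svalP s').1.1 x y; have := ss' x; lra.
      exists s => //; have := (svalP s).1.1 x y; have := ss' y; lra.
    - by exists s => //; rewrite (svalP s).1.2// ler_wpM2l// ltW.
    - by exists (sval s0 x), s0.
    - by exists (- p (- x)); exact: Elb.
  have inf_le s x : A s -> inf [set r | E x r] <= sval s x.
    move=> As; apply: ge_inf; last by exists s.
    by exists (- p (- x)); exact: Elb.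
  have infp x : inf [set r | E x r] <= p x.
    by apply: le_trans (inf_le _ _ As0) _; exact: (svalP s0).2.
  exists (exist _ (fun x => inf [set r | E x r]) (conj Ess infp) : T) => s As.
  by apply/asboolP => x /=; exact: inf_le.
exists (sval s); first exact: (svalP s).
move=> s' ss' s's.
have s'p x : s' x <= p x by apply: le_trans (s's x) _; exact: (svalP s).2.
by have /asboolP := smin (exist _ s' (conj ss' s'p) : T) (asboolT s's).
Qed.

(** The functional is the infimum over [t >= 0] of [p (x + t *: y) - t * p y].
    Applied to a minimal sublinear functional it returns the same functional, which
    makes the latter odd; applied to [p] it prescribes the value of the
    extension at [y]. *)
Lemma sublinear_slope p y : sublinear p ->
  exists s, [/\ sublinear s, forall x, s x <= p x & s (- y) <= - p y].
Proof.
move=> ps; pose E x r := exists2 t, 0 <= t & p (x + t *: y) - t * p y <= r.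
have Elb x r : E x r -> - p (- x) <= r.
  move=> [t t0]; have := ps.1 (x + t *: y) (- x).
  by rewrite addrC addKr sublinearZ//; lra.
exists (fun x => inf [set r | E x r]); split => [|x|].
- apply: sublinear_inf => [x x' r r' [t t0 tr] [t' t'0 tr']|c x r c0 [t t0 tr]|x|x].
  + exists (t + t'); first exact: addr_ge0.
    rewrite scalerDl addrACA.
    by have := ps.1 (x + t *: y) (x' + t' *: y); lra.
  + exists (c * t); first by rewrite mulr_ge0// ltW.
    by rewrite -scalerA -scalerDr ps.2// -mulrA -mulrBr ler_wpM2l// ltW.
  + by exists (p (x + 0 *: y) - 0 * p y), 0.
  + by exists (- p (- x)); exact: Elb.
- apply: ge_inf; first by exists (- p (- x)); exact: Elb.
  by exists 0 => //; rewrite scale0r addr0 mul0r subr0.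
- apply: ge_inf; first by exists (- p (- - y)); exact: Elb.
  by exists 1 => //; rewrite scale1r addNr sublinear0// mul1r sub0r.
Qed.

(** A minimal sublinear functional is linear: it is odd by [sublinear_slope],
    and subadditivity applied to opposite vectors gives additivity. *)
Theorem hahn_banach p x0 : sublinear p ->
  exists phi, [/\ linear_form phi, forall x, phi x <= p x & phi x0 = p x0].
Proof.
move=> ps; have [p' [p's p'p p'x0]] := sublinear_slope x0 ps.
have [s [ss sp'] smin] := exists_minimal_sublinear p's.
have sN x : s (- x) = - s x.
  have [s' [s's s'le s'x]] := sublinear_slope x ss.
  have := smin _ s's s'le (- x); have := sublinear_ge x ss; lra.
have sD x y : s (x + y) = s x + s y.
  have := ss.1 x y; have := ss.1 (- x) (- y).
  by rewrite -opprD !sN; lra.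
exists s; split => [a x y|x|].
- rewrite sD; congr (_ + _); have [a0|a0] := leP 0 a; first exact: sublinearZ.
  have := ss.2 (- a) x; rewrite scaleNr sN => /(_ _); lra.
- exact: le_trans (sp' x) (p'p x).
- have := sp' (- x0); have := sp' x0; have := p'p x0; rewrite sN; lra.
Qed.

End hahn_banach.

(** * Affine hulls and intrinsic cores *)
Section affine.
Context {R : realType} {V : lmodType R}.
Implicit Types (S D : set V) (x y z : V).

Lemma affine_aff_hull S : affine_set (aff_hull S).
Proof.
move=> x y t Sx Sy M [aM SM].
exact: aM (Sx M (conj aM SM)) (Sy M (conj aM SM)).
Qed.

Lemma sub_aff_hull S : S `<=` aff_hull S.
Proof. exact: sub_gen_smallest. Qed.

Lemma aff_hull_min S M : affine_set M -> S `<=` M -> aff_hull S `<=` M.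
Proof. exact: smallest_sub. Qed.

Lemma aff_hullS S D : S `<=` D -> aff_hull S `<=` aff_hull D.
Proof.
move=> SD; apply: aff_hull_min; first exact: affine_aff_hull.
exact: subset_trans SD (@sub_aff_hull _).
Qed.

Lemma affine_set_parallelogram S x y z :
  affine_set S -> S x -> S y -> S z -> S (x + y - z).
Proof.
move=> aS Sx Sy Sz.
have -> : x + y - z = 2 *: (2^-1 *: x + (1 - 2^-1) *: y) + (1 - 2) *: z.
  rewrite scalerDr !scalerA mulfV// scale1r.
  rewrite [_ * _](_ : _ = 1) ?scale1r; last lra.
  by rewrite [1 - 2](_ : _ = -1) ?scaleN1r//; lra.
by apply: (aS) => //; exact: aS.
Qed.

(** For fixed [y] the [x] with this property form an affine set, and vice versa,
    so that the claim reduces to points of [S]. *)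
Lemma aff_hull_minkowski_diff S x y :
  aff_hull S x -> aff_hull S y -> aff_hull (minkowski_diff S S) (x - y).
Proof.
have comb (t : R) x1 x2 y1 y2 :
    t *: x1 + (1 - t) *: x2 - (t *: y1 + (1 - t) *: y2) =
    t *: (x1 - y1) + (1 - t) *: (x2 - y2).
  by rewrite !scalerBr opprD addrACA.
have combx t z : t *: z + (1 - t) *: z = z by rewrite -scalerDl subrKC scale1r.
move=> Sx Sy; move: x Sx; apply: aff_hull_min => [x1 x2 t /= h1 h2|x Sx /=].
  by rewrite -[y](combx t) comb//; exact: affine_aff_hull.
move: y Sy; apply: aff_hull_min => [y1 y2 t /= h1 h2|y Sy /=].
  by rewrite -[x](combx t) comb//; exact: affine_aff_hull.
by apply: sub_aff_hull; exists x => //; exists y.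
Qed.

Lemma aff_hull_minkowski_diff_sub S D : S `<=` aff_hull D ->
  aff_hull (minkowski_diff S S) `<=` aff_hull (minkowski_diff D D).
Proof.
move=> SD; apply: aff_hull_min; first exact: affine_aff_hull.
by move=> _ [x Sx [y Sy <-]]; apply: aff_hull_minkowski_diff; exact: SD.
Qed.

Lemma intrinsic_coreS S D : S `<=` D -> D `<=` aff_hull S ->
  intrinsic_core S `<=` intrinsic_core D.
Proof.
move=> SD DS a [Sa Sax]; split=> [|x Dx]; first exact: SD.
have [|d d0 dS] := Sax x; first exact: aff_hull_minkowski_diff_sub Dx.
by exists d => // l /dS; exact: SD.
Qed.

(** Convexity with a plain real coefficient, instead of an element of the type of
    the unit interval. *)
Definition segment_closed S : Prop := forall x y t, 0 <= t <= 1 -> S x -> S y ->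
  S (t *: x + (1 - t) *: y).

Lemma convex_setP S : @convex_set R V S <-> segment_closed S.
Proof.
split=> [cS x y t /andP[t0 t1] Sx Sy|cS x y t /set_mem Sx /set_mem Sy].
  by have /set_mem := cS x y (Itv01 t0 t1) (mem_set Sx) (mem_set Sy).
apply/mem_set; apply: (cS x y t%:num) => //.
by apply/andP; split.
Qed.

(** If [a + [0, e] *: x] lies in [D], then the homothety of centre [d] and ratio
    [t] maps this segment to a segment of [D] issued from the image of [a]. *)
Lemma intrinsic_core_segment D a d t : segment_closed D ->
  intrinsic_core D a -> D d -> 0 < t <= 1 ->
  intrinsic_core D (t *: a + (1 - t) *: d).
Proof.
move=> cD [Da Dax] Dd /andP[t0 t1].
have t01 : 0 <= t <= 1 by rewrite ltW.
split=> [|x Dx]; first exact: cD.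
have [e e0 eD] := Dax x Dx; exists (t * e); first exact: mulr_gt0.
move=> l /andP[l0 lte]; rewrite addrAC -[l](mulVKf (lt0r_neq0 t0)).
rewrite -scalerA -scalerDr; apply: cD => //; apply: eD.
by rewrite ler_pdivrMl// mulr_ge0// ?invr_ge0 ltW.
Qed.

(** By [intrinsic_core_segment] the midpoint of [d] and of a point [a] of the
    core is again in the core, and [d] lies on the line through [a] and this
    midpoint. *)
Lemma sub_aff_hull_intrinsic_core D : segment_closed D ->
  intrinsic_core D !=set0 -> D `<=` aff_hull (intrinsic_core D).
Proof.
move=> cD [a ia] d Dd.
have half : 0 < (2^-1 : R) <= 1 by apply/andP; split; lra.
have -> : d = 2 *: (2^-1 *: a + (1 - 2^-1) *: d) + (1 - 2) *: a.
  rewrite scalerDr !scalerA mulfV// scale1r.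
  rewrite [_ * _](_ : _ = 1) ?scale1r; last lra.
  rewrite [1 - 2](_ : _ = -1); last lra.
  by rewrite scaleN1r addrAC subrr add0r.
apply: affine_aff_hull; apply: sub_aff_hull => //.
exact: intrinsic_core_segment.
Qed.

(** A point [a] of the core of [D] is in the core of [S]: if [a + [0, e] *: x]
    lies in [D], its first half lies in the core of [D] by
    [intrinsic_core_segment], hence in [S]. *)
Lemma intrinsic_core_sandwich S D : segment_closed D ->
  intrinsic_core D !=set0 -> intrinsic_core D `<=` S -> S `<=` D ->
  aff_hull S = aff_hull D /\ intrinsic_core S = intrinsic_core D.
Proof.
move=> cD iD0 iDS SD.
have DS : D `<=` aff_hull S.
  apply: subset_trans (sub_aff_hull_intrinsic_core cD iD0) _.
  exact: aff_hullS.
split.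
  apply/seteqP; split; first exact: aff_hullS.
  by apply: aff_hull_min => //; exact: affine_aff_hull.
apply/seteqP; split; first exact: intrinsic_coreS.
move=> a ia; split=> [|x Sx]; first exact: iDS.
have [|e e0 eD] := ia.2 x.
  by apply: aff_hull_minkowski_diff_sub Sx => z /SD/sub_aff_hull.
exists (e / 2) => [|l /andP[l0 le]]; first exact: divr_gt0.
apply: iDS; have -> : a + l *: x =
    2^-1 *: a + (1 - 2^-1) *: (a + (2 * l) *: x).
  rewrite scalerDr addrA -scalerDl subrKC scale1r scalerA.
  by congr (_ + _ *: _); lra.
apply: intrinsic_core_segment => //; last by apply/andP; split; lra.
by apply: eD; apply/andP; split; lra.
Qed.

End affine.

Lemma ic_sandwich {R : realType} {V : normedModType R} (S D : set V) :
  segment_closed D -> intrinsic_core D !=set0 ->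
  intrinsic_core D `<=` S -> S `<=` D -> ic S = ic D.
Proof.
move=> cD D0 DS SD; rewrite /ic.
by have [-> ->] := intrinsic_core_sandwich cD D0 DS SD.
Qed.

(** * Self-dual bilinear forms *)
Lemma closed_normP {R : realType} {V : normedModType R} (S : set V) :
  closed S <-> forall z, (forall e, 0 < e -> exists2 s, S s & `|z - s| <= e) -> S z.
Proof.
split=> [cS z zS|hS z cz].
  apply: cS => B /nbhs_normP[e /= e0 eB].
  have [|s Ss zs] := zS (e / 2); first exact: divr_gt0.
  by exists s; split => //; apply: eB => /=; lra.
apply: hS => e e0; have [|s [Ss zs]] := cz [set s | `|z - s| < e].
  by apply/nbhs_normP; exists e.
by exists s => //; exact: ltW.
Qed.

(** A bounded real family takes its values in a compact interval. *)
Lemma ultrafilter_bounded_cvg {R : realType} T (U : set_system T)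
    (UF : UltraFilter U) (f : T -> R) (C : R) :
  (forall t, `|f t| <= C) -> exists l : R, f t @[t --> U] --> l.
Proof.
move=> fC; have FF : ProperFilter (f @ U) by exact: fmap_proper_filter.
have [|l [_ cl]] := @segment_compact R (- C) C (f @ U) FF.
  apply: (@filterE T U) => t; rewrite /= in_itv /=.
  by have := fC t; rewrite ler_norml.
exists l => A lA; have [//|UA] := in_ultra_setVsetC (f @^-1` A) UF.
by have [x []] := cl (~` A) A UA lA.
Qed.

Section self_dual.
Context {R : realType} {Z : normedModType R}.
Implicit Types (beta : Z -> Z -> R) (z w v : Z) (Y : set Z).

(** The last two conditions say that [z |-> beta z] maps [Z] onto its topological
    dual and that the norm of [z] is at most the norm of the functional
    [beta z]. *)
Record self_dual beta : Prop := SelfDual {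
  sd_sym : forall z w, beta z w = beta w z ;
  sd_linear : forall w, linear_form (beta^~ w) ;
  sd_bounded : forall z w, `|beta z w| <= 2 * `|z| * `|w| ;
  sd_riesz : forall phi, linear_form phi ->
    (exists C, forall z, `|phi z| <= C * `|z|) -> exists v, phi = beta v ;
  sd_norm : forall z C, 0 <= C -> (forall w, `|beta z w| <= C * `|w|) ->
    `|z| <= C }.

Context {beta : Z -> Z -> R} (sd : self_dual beta).

Lemma formDl z1 z2 w : beta (z1 + z2) w = beta z1 w + beta z2 w.
Proof. by have := sd_linear sd w 1 z1 z2; rewrite scale1r mul1r. Qed.

Lemma form0l w : beta 0 w = 0.
Proof. by have := formDl 0 0 w; rewrite addr0; lra. Qed.

Lemma formZl a z w : beta (a *: z) w = a * beta z w.
Proof. by have := sd_linear sd w a z 0; rewrite form0l !addr0. Qed.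

Lemma formNl z w : beta (- z) w = - beta z w.
Proof. by rewrite -scaleN1r formZl mulN1r. Qed.

Lemma formBl z1 z2 w : beta (z1 - z2) w = beta z1 w - beta z2 w.
Proof. by rewrite formDl formNl. Qed.

Lemma formDr z w1 w2 : beta z (w1 + w2) = beta z w1 + beta z w2.
Proof. by rewrite !(sd_sym sd z) formDl. Qed.

Lemma formZr a z w : beta z (a *: w) = a * beta z w.
Proof. by rewrite !(sd_sym sd z) formZl. Qed.

Lemma formBr z w1 w2 : beta z (w1 - w2) = beta z w1 - beta z w2.
Proof. by rewrite !(sd_sym sd z) formBl. Qed.

(** The pointwise limits of [beta (z t)] along the ultrafilter define a bounded
    linear functional, which is [beta v] by self-duality. *)
Lemma weak_compactness T (U : set_system T) (UF : UltraFilter U)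
    (z : T -> Z) (C : R) : (forall t w, `|beta (z t) w| <= C * `|w|) ->
  exists v, forall w, beta (z t) w @[t --> U] --> beta v w.
Proof.
move=> zC.
have /choice[phi phiP] : forall w, exists l : R, beta (z t) w @[t --> U] --> l.
  by move=> w; exact: ultrafilter_bounded_cvg (zC ^~ w).
have [a x y||v phiv] := sd_riesz sd (phi := phi).
- have lin : beta (z t) (a *: x + y) @[t --> U] --> a * phi x + phi y.
    under eq_fun do rewrite formDr formZr.
    by apply: cvgD; [apply: cvgMl_tmp|]; exact: phiP.
  exact: (cvg_unique (@Rhausdorff R)) (phiP _) lin.
- exists C => w; apply: cvgr_to_le (cvg_norm (phiP w)) _.
  by apply: filterE => t; exact: zC.
- by exists v => w; rewrite -phiv; exact: phiP.
Qed.

Lemma weak_limit_le T (U : set_system T) (UF : UltraFilter U)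
    (z : T -> Z) v w (C : R) : beta (z t) w @[t --> U] --> beta v w ->
  (\forall t \near U, beta (z t) w <= C) -> beta v w <= C.
Proof. exact: cvgr_to_le. Qed.

Lemma weak_limit_norm_le T (U : set_system T) (UF : UltraFilter U)
    (z : T -> Z) v w (C : R) : beta (z t) w @[t --> U] --> beta v w ->
  (\forall t \near U, `|beta (z t) w| <= C) -> `|beta v w| <= C.
Proof. by move=> /cvg_norm; exact: cvgr_to_le. Qed.

(** Baire's theorem in a closed subset [Y] of [Z].  If it fails, there are nested
    balls, centred in [Y], the [n]-th one missing [S n].  The weak limit of the
    centres plays the role of the limit of a Cauchy sequence; its distance to the
    centres is estimated through [beta], at the cost of the constant [2] of
    [sd_bounded], which is why balls of doubled radius avoid [S n]. *)
Lemma baire_closed Y (S : nat -> set Z) : closed Y -> Y 0 ->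
  (forall n, closed (S n)) -> (forall u, Y u -> exists n, S n u) ->
  exists n c r, [/\ 0 < r, Y c & forall u, Y u -> `|u - c| <= r -> S n u].
Proof.
move=> cY Y0 cS YS; apply: contrapT => noS.
pose state := {p : Z * R | Y p.1 /\ 0 < p.2}.
pose next (ns : nat * state) (s : state) :=
  [/\ `|(sval s).1 - (sval ns.2).1| + (sval s).2 <= (sval ns.2).2,
      (sval s).2 <= ns.1.+1%:R^-1 &
      forall u, `|u - (sval s).1| <= 2 * (sval s).2 -> ~ S ns.1 u].
have /choice[f fP] : forall ns, exists s, next ns s.
  move=> [n [[c r] /= [Yc r0]]]; rewrite /next /=.
  have [u [Yu uc Snu]] : exists u, [/\ Y u, `|u - c| <= r / 2 & ~ S n u].
    apply: contrapT => nou; apply: noS; exists n, c, (r / 2).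
    split => // [|u Yu uc]; first exact: divr_gt0.
    by apply: contrapT => Snu; apply: nou; exists u.
  have [e e0 eS] : exists2 e, 0 < e & forall s, `|s - u| <= e -> ~ S n s.
    apply: contrapT => noe; apply: Snu; apply/(closed_normP (S n)).1 => // e e0.
    apply: contrapT => nos; apply: noe; exists e => // s se Ss; apply: nos.
    by exists s => //; rewrite distrC.
  pose d := Num.min (r / 2) (Num.min (e / 2) n.+1%:R^-1).
  have d0 : 0 < d by rewrite !lt_min invr_gt0 !divr_gt0/=.
  have [dr de dn] : [/\ d <= r / 2, d <= e / 2 & d <= n.+1%:R^-1].
    by split; rewrite /d !ge_min lexx ?orbT.
  exists (exist _ (u, d) (conj Yu d0)); split => //=; first lra.
  by move=> s su; apply: eS; lra.
pose s0 : state := exist _ (0, 1) (conj Y0 ltr01).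
pose s := fix s n := if n is m.+1 then f (m, s m) else s0.
pose c n := (sval (s n)).1; pose r n := (sval (s n)).2.
have r0 n : 0 < r n by exact: (svalP (s n)).2.
have nest n k : `|c (k + n)%N - c n| + r (k + n)%N <= r n.
  elim: k => [|k ih]; first by rewrite add0n subrr normr0 add0r.
  have [h _ _] := fP ((k + n)%N, s (k + n)%N); rewrite /= in h.
  apply: le_trans ih.
  have -> : c (k.+1 + n)%N - c n =
      (c (k.+1 + n)%N - c (k + n)%N) + (c (k + n)%N - c n) by rewrite addrA subrK.
  by have := ler_normD (c (k.+1 + n)%N - c (k + n)%N) (c (k + n)%N - c n);
     rewrite /c /r addSn /= in h *; lra.
have [U [UF eU]] := ultraFilterLemma (eventually_filter : ProperFilter \oo).
have [|v vP] := weak_compactness UF (z := c) (C := 2 * r 0%N).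
  move=> n w; have := nest 0%N n; rewrite addn0 /c /= subr0 => h.
  apply: le_trans (sd_bounded sd _ _) _; rewrite ler_wpM2r// ler_wpM2l//.
  by have := r0 n; lra.
have vc n : `|v - c n| <= 2 * r n.
  apply: (sd_norm sd); first by rewrite mulr_ge0// ltW.
  move=> w; rewrite formBl.
  apply: (cvgr_to_le (f := fun m => `|beta (c m) w - beta (c n) w|) (F := U)).
    apply: cvg_norm; apply: cvgB; [exact: vP|exact: cvg_cst].
  apply: eU; exists n => // m /= nm; rewrite -formBl.
  apply: le_trans (sd_bounded sd _ _) _; rewrite ler_wpM2r// ler_wpM2l//.
  by have := nest n (m - n)%N; rewrite subnK//; have := r0 m; lra.
have Yv : Y v.
  apply/(closed_normP Y).1 => // e e0.
  have [n] : exists n, 0 + n.+1%:R^-1 < e / 2.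
    by apply: ltr_add_invr; exact: divr_gt0.
  rewrite add0r => ne; exists (c n.+1); first exact: (svalP (s n.+1)).1.
  have rn : r n.+1 <= n.+1%:R^-1 by have [] := fP (n, s n).
  by apply: le_trans (vc n.+1) _; have := le_lt_trans rn ne; lra.
have [n Snv] := YS v Yv.
by have [_ _ /(_ v)] := fP (n, s n); apply => //; exact: (vc n.+1).
Qed.

End self_dual.

(** * Maximal positive sets and Fitzpatrick functions *)
Section positive_sets.
Context {R : realType} {Z : normedModType R}.
Implicit Types (beta : Z -> Z -> R) (z w v a b : Z) (A B Y : set Z).

(** Lemmas on [-B] are those on [A] applied to the opposite form. *)
Definition opp_form beta : Z -> Z -> R := fun z w => - beta z w.

Definition qform beta z : R := beta z z / 2.

(** Maximality in the form used for monotone operators: a point positively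
    related to all of [A] belongs to [A]. *)
Definition maximal_positive beta A : Prop :=
  (forall a b, A a -> A b -> 0 <= qform beta (a - b)) /\
  (forall z, (forall a, A a -> 0 <= qform beta (z - a)) -> A z).

(** The epigraph of the Fitzpatrick function; working with it keeps all values
    real. *)
Definition fitz_le beta A z (r : R) : Prop :=
  forall a, A a -> beta z a - qform beta a <= r.

Definition fitz_dom beta A : set Z := [set z | exists r, fitz_le beta A z r].

Lemma self_dual_opp beta : self_dual beta -> self_dual (opp_form beta).
Proof.
move=> sd; split => [z w|w a x y|z w|phi lphi [C phiC]|z C C0 zC].
- by rewrite /opp_form (sd_sym sd).
- by rewrite /opp_form (sd_linear sd) opprD mulrN.
- by rewrite normrN; exact: sd_bounded.
- have [||v phiv] := sd_riesz sd (phi := fun z => - phi z).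
  + by move=> a x y; rewrite lphi opprD mulrN.
  + by exists C => z; rewrite normrN.
  + exists v; apply/funext => z; rewrite /opp_form.
    by have /(congr1 (fun f => f z)) := phiv; lra.
- by apply: (sd_norm sd) => // w; have := zC w; rewrite normrN.
Qed.

Section theory.
Context {beta : Z -> Z -> R} (sd : self_dual beta).

Local Notation q := (qform beta).

Lemma qformB z w : q (z - w) = q z - beta z w + q w.
Proof.
rewrite /qform (formBl sd) !(formBr sd) (sd_sym sd w z); lra.
Qed.

Lemma qformD z w : q (z + w) = q z + beta z w + q w.
Proof.
rewrite /qform (formDl sd) !(formDr sd) (sd_sym sd w z); lra.
Qed.

Lemma qform0 : q 0 = 0.
Proof. by rewrite /qform (form0l sd) mul0r. Qed.

Lemma qformZ t z : q (t *: z) = t ^+ 2 * q z.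
Proof. by rewrite /qform (formZl sd) (formZr sd); ring. Qed.

Lemma fitz_le_self A a : maximal_positive beta A -> A a -> fitz_le beta A a (q a).
Proof.
by move=> [pA _] Aa a' Aa'; have := pA _ _ Aa Aa'; rewrite qformB; lra.
Qed.

(** Outside [A], maximality provides [a] with [q (z - a) < 0], that is
    [q z < beta z a - q a]; at a point of [A] take [a = z]. *)
Lemma fitz_le_ge A z r : maximal_positive beta A -> fitz_le beta A z r -> q z <= r.
Proof.
move=> [pA mA] zr; rewrite leNgt; apply/negP => rz.
have Az : A z by apply: mA => a /zr; rewrite qformB; lra.
by have := zr z Az; rewrite /qform in rz *; lra.
Qed.

Lemma fitz_le_trans A z r s : r <= s -> fitz_le beta A z r -> fitz_le beta A z s.
Proof. by move=> rs zr a /zr az; exact: le_trans rs. Qed.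

Lemma fitz_le_convex A z1 z2 r1 r2 t : 0 <= t <= 1 ->
  fitz_le beta A z1 r1 -> fitz_le beta A z2 r2 ->
  fitz_le beta A (t *: z1 + (1 - t) *: z2) (t * r1 + (1 - t) * r2).
Proof.
move=> /andP[t0 t1] z1r z2r a Aa.
rewrite (formDl sd) !(formZl sd).
have := ler_wpM2l t0 (z1r a Aa).
have t10 : 0 <= 1 - t by rewrite subr_ge0.
have := ler_wpM2l t10 (z2r a Aa); lra.
Qed.

Lemma sub_fitz_dom A : maximal_positive beta A -> A `<=` fitz_dom beta A.
Proof. by move=> mA a Aa; exists (q a); exact: fitz_le_self. Qed.

Lemma fitz_dom_segment_closed A : segment_closed (fitz_dom beta A).
Proof.
move=> x y t t01 [r xr] [s ys]; exists (t * r + (1 - t) * s).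
exact: fitz_le_convex.
Qed.

(** The Fitzpatrick function is weakly lower semicontinuous, being a supremum of
    weakly continuous affine functions. *)
Lemma fitz_le_weak_limit A T (U : set_system T) (UF : UltraFilter U)
    (z : T -> Z) v r : (forall w, beta (z t) w @[t --> U] --> beta v w) ->
  (\forall t \near U, fitz_le beta A (z t) r) -> fitz_le beta A v r.
Proof.
move=> zv zr a Aa.
rewrite lerBlDr; apply: (weak_limit_le UF (zv a)); apply: filterS zr => t.
by move=> /(_ a Aa); rewrite lerBlDr.
Qed.

Lemma maximal_positive_shift A w : maximal_positive beta A ->
  maximal_positive beta [set z | A (z + w)].
Proof.
move=> [pA mA]; split=> [a b /= Aa Ab|z /= zA].
  by have := pA _ _ Aa Ab; rewrite opprD addrACA subrr addr0.
apply: mA => a Aa; have := zA (a - w); rewrite subrK => /(_ Aa).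
by rewrite opprB addrA (addrAC z).
Qed.

Lemma fitz_le_shift A w z r :
  fitz_le beta [set z | A (z + w)] z r <->
  fitz_le beta A (z + w) (r + beta z w + q w).
Proof.
have eqn a : beta (z + w) a - q a = beta z (a - w) - q (a - w) + beta z w + q w.
  by rewrite qformB (formBr sd) (formDl sd) (sd_sym sd a w); lra.
split=> zr a /= Aa.
  have /zr : [set z | A (z + w)] (a - w) by rewrite /= subrK.
  by rewrite eqn; lra.
by have := zr (a + w) Aa; rewrite eqn addrK; lra.
Qed.

Lemma fitz_dom_shift A w z :
  fitz_dom beta [set z | A (z + w)] z <-> fitz_dom beta A (z + w).
Proof.
split=> [[r /fitz_le_shift zr]|[r zr]]; first by exists (r + beta z w + q w).
exists (r - beta z w - q w); apply/fitz_le_shift.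
have -> : r - beta z w - q w + beta z w + q w = r by lra.
exact: zr.
Qed.

End theory.

Section attouch_brezis.
Context {beta : Z -> Z -> R} (sd : self_dual beta).
Context {A B : set Z} (mA : maximal_positive beta A)
  (mB : maximal_positive (opp_form beta) B).

Let sd' := self_dual_opp sd.
Local Notation q := (qform beta).
Local Notation fA := (fitz_le beta A).
Local Notation fB := (fitz_le (opp_form beta) B).

Lemma qform_opp z : qform (opp_form beta) z = - q z.
Proof. by rewrite /qform /opp_form mulNr. Qed.

(** The norm bound is imposed on the functionals [beta z1] and [beta z2] because
    in this form it visibly passes to weak limits. *)
Definition sublevel_diff (n : nat) : set Z :=
  [set u | exists z1 z2, [/\ u = z1 - z2, fA z1 n%:R, fB z2 n%:R &
     forall w, `|beta z1 w| <= n%:R * `|w| /\ `|beta z2 w| <= n%:R * `|w|]].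

Lemma sublevel_diff_segment_closed n : segment_closed (sublevel_diff n).
Proof.
move=> x y t t01 [x1 [x2 [-> x1n x2n xn]]] [y1 [y2 [-> y1n y2n yn]]].
exists (t *: x1 + (1 - t) *: y1), (t *: x2 + (1 - t) *: y2); split.
- by rewrite !scalerBr opprD addrACA.
- by have := fitz_le_convex sd t01 x1n y1n; rewrite -mulrDl subrKC mul1r.
- by have := fitz_le_convex sd' t01 x2n y2n; rewrite -mulrDl subrKC mul1r.
have comb (c d m : R) : `|c| <= m -> `|d| <= m -> `|t * c + (1 - t) * d| <= m.
  have /andP[t0 t1] := t01; have t10 : 0 <= 1 - t by rewrite subr_ge0.
  move=> cm dm; apply: le_trans (ler_normD _ _) _.
  rewrite !normrM (ger0_norm t0) (ger0_norm t10).
  by have := ler_wpM2l t0 cm; have := ler_wpM2l t10 dm; lra.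
move=> w; have [? ?] := xn w; have [? ?] := yn w.
by split; rewrite (formDl sd) !(formZl sd); exact: comb.
Qed.

Lemma sublevel_diff_mono m n : (m <= n)%N -> sublevel_diff m `<=` sublevel_diff n.
Proof.
rewrite -(ler_nat R) => mn _ [z1 [z2 [-> z1m z2m zm]]]; exists z1, z2; split=> //.
- exact: fitz_le_trans mn z1m.
- exact: fitz_le_trans mn z2m.
- move=> w; have [h1 h2] := zm w.
  by split; [apply: le_trans h1 _|apply: le_trans h2 _]; rewrite ler_wpM2r.
Qed.

(** Points of the set that approach [u] have decompositions which are weakly
    compact; the weak limits of the two components decompose [u]. *)
Lemma closed_sublevel_diff n : closed (sublevel_diff n).
Proof.
apply/closed_normP => u uS.
have /choice[z zP] : forall k : nat, exists z : Z * Z,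
    [/\ `|u - (z.1 - z.2)| <= k.+1%:R^-1, fA z.1 n%:R, fB z.2 n%:R &
     forall w, `|beta z.1 w| <= n%:R * `|w| /\ `|beta z.2 w| <= n%:R * `|w|].
  move=> k; have [|_ [z1 [z2 [-> z1n z2n zn]]] uz] := uS k.+1%:R^-1.
    by rewrite invr_gt0.
  by exists (z1, z2).
have [U [UF eU]] := ultraFilterLemma (eventually_filter : ProperFilter \oo).
have [|v1 v1P] := weak_compactness sd UF (z := fun k => (z k).1) (C := n%:R).
  by move=> k w; have [_ _ _ /(_ w)[]] := zP k.
have [|v2 v2P] := weak_compactness sd UF (z := fun k => (z k).2) (C := n%:R).
  by move=> k w; have [_ _ _ /(_ w)[]] := zP k.
exists v1, v2; split.
- apply/eqP; rewrite -subr_eq0 -normr_le0; apply/ler_addgt0Pr => e e0.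
  rewrite add0r; apply: (sd_norm sd); first exact: ltW.
  move=> w; have [k0] : exists k, 0 + k.+1%:R^-1 < e / 2.
    by apply: ltr_add_invr; exact: divr_gt0.
  rewrite add0r => k0e; rewrite (formBl sd).
  apply: (cvgr_to_le (f := fun k => `|beta u w - beta ((z k).1 - (z k).2) w|) (F := U)).
    apply: cvg_norm; apply: cvgB; first exact: cvg_cst.
    rewrite (formBl sd); under eq_fun do rewrite (formBl sd).
    by apply: cvgB; [exact: v1P|exact: v2P].
  apply: eU; exists k0 => // k /= k0k; rewrite -(formBl sd).
  apply: le_trans (sd_bounded sd _ _) _; rewrite ler_wpM2r//.
  have [uk _ _ _] := zP k.
  have kk0 : (k.+1%:R^-1 : R) <= k0.+1%:R^-1 by rewrite lef_pV2 ?posrE// ler_nat.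
  by have := le_trans uk (le_trans kk0 (ltW k0e)); lra.
- apply: (fitz_le_weak_limit UF v1P); apply: filterE => k.
  by have [] := zP k.
- apply: (fitz_le_weak_limit (beta := opp_form beta) UF (z := fun k => (z k).2)).
    by move=> w; apply: cvgN; exact: v2P.
  by apply: filterE => k; have [] := zP k.
- move=> w; split; [apply: (weak_limit_norm_le UF (v1P w))|
                    apply: (weak_limit_norm_le UF (v2P w))];
    by apply: filterE => k; have [_ _ _ /(_ w)[]] := zP k.
Qed.

Local Notation D := (minkowski_diff (fitz_dom beta A) (fitz_dom (opp_form beta) B)).

Lemma fitz_dom_diff_sublevel u : D u -> exists n, sublevel_diff n u.
Proof.
move=> [z1 [r1 z1r] [z2 [r2 z2r] <-]].
pose x := `|r1| + `|r2| + 2 * `|z1| + 2 * `|z2|.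
have [n xn] : exists n, x <= n%:R.
  by exists (Num.bound x); apply/ltW/archi_boundP; rewrite !addr_ge0.
have [p1 p2 p3 p4] : [/\ 0 <= `|r1|, 0 <= `|r2|, 0 <= `|z1| & 0 <= `|z2|] by [].
exists n, z1, z2; split=> //.
- by apply: fitz_le_trans z1r; have := ler_norm r1; rewrite /x in xn; lra.
- by apply: fitz_le_trans z2r; have := ler_norm r2; rewrite /x in xn; lra.
- by move=> w; split; apply: le_trans (sd_bounded sd _ _) _; rewrite ler_wpM2r//;
     rewrite /x in xn; lra.
Qed.

(** The dilations [T n] of the sublevel differences cover [Y], so that one of them
    contains a ball of [Y], say centred at [c].  Since [- c] is also reached by some
    [T n'], convexity moves the ball to the origin. *)
Lemma sublevel_diff_absorbs Y : closed Y -> Y 0 ->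
  (forall t u, Y u -> Y (t *: u)) -> (forall u v, Y u -> Y v -> Y (u + v)) ->
  (forall u, Y u -> exists2 d : R, 0 < d & D (d *: u)) ->
  exists m, exists2 rho : R, 0 < rho &
    forall u, Y u -> `|u| <= rho -> sublevel_diff m u.
Proof.
move=> cY Y0 YZ YD Yabs.
have [n0 S0] : exists n, sublevel_diff n 0.
  by have [d _] := Yabs 0 Y0; rewrite scaler0 => /fitz_dom_diff_sublevel.
have shrink n u t : (n0 <= n)%N -> 0 <= t <= 1 -> sublevel_diff n u ->
    sublevel_diff n (t *: u).
  move=> n0n t01 Su; rewrite -[_ *: _]addr0 -(scaler0 _ (1 - t)).
  by apply: sublevel_diff_segment_closed => //; exact: sublevel_diff_mono S0.
pose T n := [set u | sublevel_diff n (n.+1%:R^-1 *: u)].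
have closedT n : closed (T n).
  apply/closed_normP => u uT; apply/(closed_normP (sublevel_diff n)).1.
    exact: closed_sublevel_diff.
  move=> e e0; have [|s Ts us] := uT (n.+1%:R * e); first exact: mulr_gt0.
  exists (n.+1%:R^-1 *: s) => //.
  by rewrite -scalerBr normrZ gtr0_norm ?invr_gt0// ler_pdivrMl.
have coverT u : Y u -> exists n, T n u.
  move=> /Yabs[d d0 /fitz_dom_diff_sublevel[n1 Su]].
  pose N := maxn (maxn n0 n1) (Num.bound d^-1).
  have n0N : (n0 <= N)%N by rewrite !leq_max leqnn.
  have n1N : (n1 <= N)%N by rewrite !leq_max leqnn orbT.
  have dN : d^-1 <= N.+1%:R.
    apply: le_trans (ltW (archi_boundP _)) _; first by rewrite invr_ge0 ltW.
    by rewrite ler_nat ltnW// ltnS leq_max leqnn orbT.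
  exists N; rewrite /T /=.
  have -> : N.+1%:R^-1 *: u = (N.+1%:R^-1 / d) *: (d *: u).
    by rewrite scalerA divfK// gt_eqF.
  apply: shrink => //; last exact: sublevel_diff_mono Su.
  apply/andP; split; first by rewrite divr_ge0 ?invr_ge0// ltW.
  by rewrite ler_pdivrMl// mulr1.
have [n [c [r [r0 Yc cT]]]] := baire_closed sd cY Y0 closedT coverT.
have [n' cT'] : exists n', T n' (- c) by apply: coverT; rewrite -scaleN1r; exact: YZ.
pose k : R := n.+1%:R^-1; pose l : R := n'.+1%:R^-1.
have k0 : 0 < k by rewrite invr_gt0.
have l0 : 0 < l by rewrite invr_gt0.
have kl0 : 0 < k + l by exact: addr_gt0.
exists (maxn n n'), (r * (k * l / (k + l))).
  by rewrite mulr_gt0// divr_gt0// mulr_gt0.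
(* u is a convex combination of a point of the ball around c and of - l *: c *)
move=> u Yu ur; pose h := ((k + l) / (k * l)) *: u.
have hr : `|h| <= r.
  have kl : 0 < (k + l) / (k * l) by rewrite divr_gt0// mulr_gt0.
  by rewrite normrZ (gtr0_norm kl) -ler_pdivlMl// invf_div mulrC.
have Sh : sublevel_diff n (k *: (c + h)).
  by apply: cT; [apply: YD => //; exact: YZ|rewrite (addrC c) addrK].
have -> : u = (l / (k + l)) *: (k *: (c + h)) +
    (1 - l / (k + l)) *: (l *: - c).
  have -> : 1 - l / (k + l) = k / (k + l) by field; rewrite gt_eqF.
  rewrite !scalerA scalerDr scalerN mulrAC [k / _ * l]mulrAC (mulrC l k).
  rewrite addrAC subrr add0r /h scalerA.
  rewrite [X in X *: _](_ : _ = 1) ?scale1r//.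
  by field; rewrite !gt_eqF.
apply: sublevel_diff_segment_closed.
- apply/andP; split; first by rewrite divr_ge0// ltW.
  by rewrite ler_pdivrMr// mul1r lerDr ltW.
- by apply: sublevel_diff_mono Sh; rewrite leq_maxl.
- by apply: sublevel_diff_mono cT'; rewrite leq_maxr.
Qed.

(** The two Fitzpatrick functions dominate [q] and [- q] respectively. *)
Lemma fitz_diag_ge0 z r1 r2 : fA z r1 -> fB z r2 -> 0 <= r1 + r2.
Proof.
move=> /(fitz_le_ge sd mA) h1 /(fitz_le_ge sd' mB).
by rewrite qform_opp; lra.
Qed.

(** Let [d = |z1 - z2|].  The vector of norm [rho] opposite to [z1 - z2] is some
    [y1 - y2] with bounded Fitzpatrick values.  The convex combination with weights
    [rho / (rho + d)] and [d / (rho + d)] falls on the diagonal, where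
    [fitz_diag_ge0] applies. *)
Lemma fitz_sum_lipschitz Y m (rho : R) :
  (forall t u, Y u -> Y (t *: u)) ->
  (forall u, D u -> Y u) -> 0 < rho ->
  (forall u, Y u -> `|u| <= rho -> sublevel_diff m u) ->
  forall z1 z2 r1 r2, fA z1 r1 -> fB z2 r2 ->
    0 <= r1 + r2 + 2 * m%:R / rho * `|z1 - z2|.
Proof.
move=> YZ DY rho0 Ym z1 z2 r1 r2 z1r z2r.
have [d0|d0] := eqVneq `|z1 - z2| 0.
  have z12 : z1 = z2 by apply: subr0_eq; exact: normr0_eq0.
  by rewrite d0 mulr0 addr0; apply: (fitz_diag_ge0 z1r); rewrite z12.
have {}d0 : 0 < `|z1 - z2| by rewrite lt0r d0 normr_ge0.
have Yd : Y (z1 - z2).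
  by apply: DY; exists z1; [exists r1|exists z2 => //; exists r2].
set d := `|z1 - z2| in d0 *.
have [|y1 [y2 [yd y1m y2m _]]] := Ym (- (rho / d) *: (z1 - z2)) (YZ _ _ Yd).
  by rewrite normrZ normrN ger0_norm ?divfK ?gt_eqF// divr_ge0 ?ltW.
(* the weight for which s * d = (1 - s) * rho *)
pose s := rho / (rho + d).
have rd0 : 0 < rho + d by exact: addr_gt0.
have s01 : 0 <= s <= 1.
  apply/andP; split; first by rewrite divr_ge0// ltW.
  by rewrite ler_pdivrMr// mul1r lerDl ltW.
have eqz : s *: z1 + (1 - s) *: y1 = s *: z2 + (1 - s) *: y2.
  apply/eqP; rewrite -subr_eq0 opprD addrACA -!scalerBr -yd scalerA -scalerDl.
  rewrite [X in X *: _](_ : _ = 0) ?scale0r// /s; field.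
  by rewrite !gt_eqF.
have h1 := fitz_le_convex sd s01 z1r y1m.
have h2 := fitz_le_convex sd' s01 z2r y2m.
rewrite eqz in h1; have := fitz_diag_ge0 h1 h2.
have -> : r1 + r2 + 2 * m%:R / rho * d =
   (rho + d) / rho * (s * r1 + (1 - s) * m%:R + (s * r2 + (1 - s) * m%:R)).
  by rewrite /s; field; rewrite !gt_eqF.
by move=> h; rewrite mulr_ge0// divr_ge0// ltW.
Qed.

(** The Hahn-Banach theorem is applied to the sublinear functional
    [u |-> inf (t * (FA z1 + FB z2) + K * |u - t *: (z1 - z2)|)] over [t > 0] and
    [z1, z2]: it is bounded below by [- K * |u|] thanks to the Lipschitz bound, and
    above by [K * |u|], which makes the linear minorant continuous.  With [t = 1],
    [z1 = a] and [z2 = b] it is at most [q a - q b] at [a - b]. *)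
Lemma separating_vector K : 0 <= K ->
  (exists z r1 r2, fA z r1 /\ fB z r2) ->
  (forall z1 z2 r1 r2, fA z1 r1 -> fB z2 r2 ->
    0 <= r1 + r2 + K * `|z1 - z2|) ->
  exists v, forall a b, A a -> B b -> beta (a - b) v <= q a - q b.
Proof.
move=> K0 [z0 [s1 [s2 [z0s1 z0s2]]]] Klb.
(* perspectives of the Fitzpatrick functions: z stands for t *: z1 *)
pose hA t z r := forall a, A a -> beta z a - t * q a <= r.
pose hB t z r := forall b, B b -> t * q b - beta z b <= r.
have hAP t z r : 0 < t -> hA t z r -> fA (t^-1 *: z) (t^-1 * r).
  move=> t0 zr a Aa; rewrite (formZl sd) -[qform _ _](mulKf (lt0r_neq0 t0)).
  by rewrite -mulrBr ler_pM2l ?invr_gt0//; exact: zr.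
have hBP t z r : 0 < t -> hB t z r -> fB (t^-1 *: z) (t^-1 * r).
  move=> t0 zr b Bb; rewrite qform_opp /opp_form (formZl sd).
  rewrite opprK addrC -[qform _ _](mulKf (lt0r_neq0 t0)).
  by rewrite -mulrBr ler_pM2l ?invr_gt0//; exact: zr.
pose E u r := exists t z1 z2 r1 r2, [/\ 0 < t, hA t z1 r1, hB t z2 r2 &
  r1 + r2 + K * `|u - (z1 - z2)| <= r].
have Elb u r : E u r -> - (K * `|u|) <= r.
  move=> [t [z1 [z2 [r1 [r2 [t0 z1r z2r]]]]]]; apply: le_trans.
  have := Klb _ _ _ _ (hAP _ _ _ t0 z1r) (hBP _ _ _ t0 z2r).
  rewrite -scalerBr normrZ (gtr0_norm (_ : 0 < t^-1)) ?invr_gt0//.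
  rewrite -mulrDr (mulrCA K) -mulrDr pmulr_rge0 ?invr_gt0// => h.
  have tri : `|z1 - z2| <= `|u - (z1 - z2)| + `|u|.
    by rewrite (distrC u); have := ler_normD (z1 - z2 - u) u; rewrite subrK.
  by have := ler_wpM2l K0 tri; rewrite mulrDr; lra.
(* z1 = z2 = z0 leaves only the distance term as t tends to 0 *)
have E1 t u : 0 < t -> E u (t * (s1 + s2) + K * `|u|).
  move=> t0; exists t, (t *: z0), (t *: z0), (t * s1), (t * s2); split=> //.
  - move=> a Aa; rewrite (formZl sd) -mulrBr ler_pM2l//; exact: z0s1.
  - move=> b Bb; rewrite (formZl sd) -mulrBr ler_pM2l//.
    by have := z0s2 b Bb; rewrite qform_opp /opp_form opprK addrC.
  - by rewrite subrr subr0 mulrDr.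
have Esub : sublinear (fun u => inf [set r | E u r]).
  apply: sublinear_inf => [x y r s|t x r t0|x|x].
  - move=> [t [z1 [z2 [r1 [r2 [t0 z1r z2r rr]]]]]].
    move=> [t' [z1' [z2' [r1' [r2' [t0' z1r' z2r' rr']]]]]].
    exists (t + t'), (z1 + z1'), (z2 + z2'), (r1 + r1'), (r2 + r2'); split.
    + exact: addr_gt0.
    + move=> a Aa; rewrite (formDl sd).
      by have := z1r a Aa; have := z1r' a Aa; lra.
    + move=> b Bb; rewrite (formDl sd).
      by have := z2r b Bb; have := z2r' b Bb; lra.
    + have -> : x + y - (z1 + z1' - (z2 + z2')) =
        (x - (z1 - z2)) + (y - (z1' - z2')).
        by rewrite [RHS]addrACA -opprD; congr (_ - _); rewrite opprD addrACA.
      have := ler_wpM2l K0 (ler_normD (x - (z1 - z2)) (y - (z1' - z2'))).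
      rewrite mulrDr; lra.
  - move=> [s [z1 [z2 [r1 [r2 [s0 z1r z2r rr]]]]]].
    exists (t * s), (t *: z1), (t *: z2), (t * r1), (t * r2); split.
    + exact: mulr_gt0.
    + by move=> a Aa; rewrite (formZl sd) -mulrA -mulrBr ler_pM2l//; exact: z1r.
    + by move=> b Bb; rewrite (formZl sd) -mulrA -mulrBr ler_pM2l//; exact: z2r.
    + rewrite -!scalerBr normrZ (gtr0_norm t0) mulrCA -!mulrDr ler_pM2l//.
  - by exists (1 * (s1 + s2) + K * `|x|); exact: E1.
  - by exists (- (K * `|x|)) => r; exact: Elb.
have [phi [lphi phip _]] := hahn_banach 0 Esub.
have phiE u r : E u r -> phi u <= r.
  move=> Eur; apply: le_trans (phip u) _; apply: ge_inf => //.
  by exists (- (K * `|u|)) => s; exact: Elb.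
have phiK u : phi u <= K * `|u|.
  have s0 : 0 <= s1 + s2 by exact: fitz_diag_ge0 z0s1 z0s2.
  apply/ler_addgt0Pr => e e0; have t0 : 0 < e / (s1 + s2 + 1).
    by rewrite divr_gt0//; lra.
  apply: le_trans (phiE _ _ (E1 _ u t0)) _; rewrite addrC lerD2l.
  rewrite mulrAC ler_pdivrMr; last lra.
  by rewrite ler_pM2l//; lra.
have [//||v phiv] := sd_riesz sd (phi := phi).
  exists K => u; rewrite ler_norml phiK andbT.
  by have := phiK (- u); rewrite linear_formN// normrN; lra.
exists v => a b Aa Bb; rewrite (sd_sym sd) -phiv; apply: phiE.
exists 1, a, b, (q a), (- q b); split=> //.
- by move=> a' Aa'; rewrite mul1r; exact: (fitz_le_self sd mA Aa).
- move=> b' Bb'; have := fitz_le_self sd' mB Bb Bb'.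
  by rewrite !qform_opp /opp_form mul1r; lra.
- by rewrite subrr normr0 mulr0 addr0.
Qed.

(** The hypothesis reads [q (b - v) <= q (a - v)].  If [v] is in [A], take
    [a = v]: then [v] is negatively related to [B], so [v] is in [B].  If not, some
    [q (a - v)] is negative, hence so are all [q (b - v)]; thus [v] is again in [B],
    and [b = v] gives [0 < 0]. *)
Lemma maximal_positive_meet v :
  (forall a b, A a -> B b -> beta (a - b) v <= q a - q b) -> A v /\ B v.
Proof.
move=> hv; have sep a b : A a -> B b -> q (b - v) <= q (a - v).
  by move=> Aa /(hv a b Aa); rewrite !(qformB sd) (formBl sd); lra.
have qs x y : q (x - y) = q (y - x) by rewrite !(qformB sd) (sd_sym sd y x); lra.
have [Av|nAv] := pselect (A v).
  split=> //; apply: mB.2 => b /(sep _ _ Av).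
  by rewrite subrr (qform0 sd) qform_opp (qs v b); lra.
have [a Aa av] : exists2 a, A a & q (v - a) < 0.
  apply: contrapT => noa; apply: nAv; apply: mA.2 => a Aa; rewrite leNgt.
  by apply/negP => av; apply: noa; exists a.
have Bv : B v.
  apply: mB.2 => b /(sep _ _ Aa); rewrite qform_opp (qs v b).
  by rewrite (qs a v); lra.
by have := sep _ _ Aa Bv; rewrite subrr (qform0 sd) (qs a v); lra.
Qed.

End attouch_brezis.
End positive_sets.

(** * The difference of two Fitzpatrick domains *)
Section constant_functional.
Context {R : realType} {Z : normedModType R} {beta : Z -> Z -> R}.
Context (sd : self_dual beta).
Implicit Types (A : set Z) (v : Z).
Local Notation q := (qform beta).

(** [q (a + t *: v - a') = q (a - a') + t ^+ 2 * q v], since the cross term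
    vanishes. *)
Lemma constant_form_shift A v c : maximal_positive beta A ->
  (forall a, A a -> beta a v = c) -> 0 <= q v ->
  forall a t, A a -> A (a + t *: v).
Proof.
move=> [pA mA] Avc qv a t Aa; apply: mA => a' Aa'.
rewrite addrAC (qformD sd) (qformZ sd) (formZr sd) (formBl sd) !Avc//.
rewrite subrr mulr0 addr0; apply: addr_ge0; first exact: pA.
by rewrite mulr_ge0// sqr_ge0.
Qed.

(** Both [a] and [a + v] are in [A], so that [beta v v = 0]. *)
Lemma constant_form_isotropic A v c : maximal_positive beta A -> A !=set0 ->
  (forall a, A a -> beta a v = c) -> 0 <= q v -> q v = 0.
Proof.
move=> mA [a Aa] Avc qv; have Av := constant_form_shift mA Avc qv 1 Aa.
have := Avc _ Av; rewrite (formDl sd) (formZl sd) Avc// /qform; lra.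
Qed.

(** The line through [a] directed by the isotropic vector [v] lies in [A]; along
    it the affine functions defining the Fitzpatrick function at [z] have slope
    [beta z v - c], which must vanish for their supremum to be finite. *)
Lemma constant_form_fitz_dom A v c : maximal_positive beta A -> A !=set0 ->
  (forall a, A a -> beta a v = c) -> q v = 0 ->
  forall z, fitz_dom beta A z -> beta z v = c.
Proof.
move=> mA [a Aa] Avc qv z [r zr]; apply/eqP; rewrite -subr_eq0; apply/negPn/negP => zc0.
have qv0 : 0 <= q v by rewrite qv.
have h t : t * (beta z v - c) <= r - beta z a + q a.
  have := zr _ (constant_form_shift mA Avc qv0 t Aa).
  rewrite (qformD sd) (qformZ sd) qv (formDr sd) !(formZr sd) (Avc a Aa); lra.
by have := h ((r - beta z a + q a + 1) / (beta z v - c)); rewrite divfK//; lra.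
Qed.

End constant_functional.

Section fitz_dom_diff.
Context {R : realType} {Z : normedModType R} {beta : Z -> Z -> R}.
Context (sd : self_dual beta).
Context {A B : set Z} (mA : maximal_positive beta A)
  (mB : maximal_positive (opp_form beta) B).

Let sd' := self_dual_opp sd.
Local Notation q := (qform beta).
Local Notation D := (minkowski_diff (fitz_dom beta A) (fitz_dom (opp_form beta) B)).

Lemma fitz_dom_diff_segment_closed : segment_closed D.
Proof.
move=> _ _ t t01 [x1 Ax1 [x2 Bx2 <-]] [y1 Ay1 [y2 By2 <-]].
exists (t *: x1 + (1 - t) *: y1); first exact: fitz_dom_segment_closed.
exists (t *: x2 + (1 - t) *: y2); first exact: fitz_dom_segment_closed.
by rewrite !scalerBr opprD addrACA.
Qed.

(** The form is constant along [v] on [A] and on [B]; one of [q v] and [- q v] is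
    nonnegative, and whichever it is forces [q v = 0]. *)
Lemma constant_form_fitz_dom_diff v c : A !=set0 -> B !=set0 ->
  (forall a b, A a -> B b -> beta (a - b) v = c) ->
  forall z, D z -> beta z v = c.
Proof.
move=> [a0 Aa0] [b0 Bb0] hc _ [z1 Az1 [z2 Bz2 <-]].
have Ac a : A a -> beta a v = c + beta b0 v.
  by move=> /hc/(_ Bb0); rewrite (formBl sd); lra.
have Bc b : B b -> opp_form beta b v = c - beta a0 v.
  by move=> /(hc _ _ Aa0); rewrite (formBl sd) /opp_form; lra.
have A0 : A !=set0 by exists a0.
have B0 : B !=set0 by exists b0.
have qv : q v = 0.
  have [qv|/ltW qv] := leP 0 (q v); first exact: constant_form_isotropic Ac qv.
  have := constant_form_isotropic sd' mB B0 Bc; rewrite qform_opp; lra.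
rewrite (formBl sd) (constant_form_fitz_dom sd mA A0 Ac qv Az1).
have := constant_form_fitz_dom sd' mB B0 Bc _ Bz2.
rewrite qform_opp qv oppr0 /opp_form => /(_ erefl).
by have := hc _ _ Aa0 Bb0; rewrite (formBl sd); lra.
Qed.

(** A point [z] of [D] outside the closed affine set [M] would be separated from
    [M] by a linear functional below the distance to the direction of [M]; this
    functional is [beta v], constant on [M], contradicting
    [constant_form_fitz_dom_diff]. *)
Lemma fitz_dom_diff_sub_affine M : affine_set M -> closed M ->
  minkowski_diff A B !=set0 -> minkowski_diff A B `<=` M -> D `<=` M.
Proof.
move=> aM cM [_ [a0 Aa0 [b0 Bb0 _]]] GM z Dz; apply: contrapT => nMz.
pose g := a0 - b0.
have Mg : M g by apply: GM; exists a0 => //; exists b0.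
have M0Z t m : M (g + m) -> M (g + t *: m).
  move=> Mm; have -> : g + t *: m = t *: (g + m) + (1 - t) *: g.
    by rewrite scalerDr scalerBl scale1r [RHS]addrC [RHS]addrA subrK.
  exact: aM.
have M0D m n : M (g + m) -> M (g + n) -> M (g + (m + n)).
  move=> Mm Mn; have -> : g + (m + n) = g + m + (g + n) - g.
    by rewrite [g + m + _]addrA [RHS]addrAC addrK addrA.
  exact: affine_set_parallelogram.
have [e e0 eM] : exists2 e, 0 < e & forall s, M s -> e <= `|z - s|.
  apply: contrapT => noe; apply: nMz; apply/(closed_normP M).1 => // e e0.
  apply: contrapT => nos; apply: noe; exists e => // s Ms.
  by rewrite leNgt; apply/negP => zs; apply: nos; exists s => //; exact: ltW.
pose E x r := exists2 m, M (g + m) & `|x - m| <= r.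
have Elb x : forall r, E x r -> 0 <= r by move=> r [m _]; exact: le_trans.
have psub : sublinear (fun x => inf [set r | E x r]).
  apply: sublinear_inf => [x y r s [m Mm xm] [n Mn yn]|t x r t0 [m Mm xm]|x|x].
  - exists (m + n); first exact: M0D.
    by rewrite opprD addrACA (le_trans (ler_normD _ _))// lerD.
  - exists (t *: m); first exact: M0Z.
    by rewrite -scalerBr normrZ (gtr0_norm t0) ler_pM2l.
  - by exists `|x - 0|, 0 => //; rewrite addr0.
  - by exists 0; exact: Elb.
have [phi [lphi phip phiz]] := hahn_banach (z - g) psub.
have phiE x r : E x r -> phi x <= r.
  move=> Exr; apply: le_trans (phip x) _; apply: ge_inf => //.
  by exists 0; exact: Elb.
have phiN x := linear_formN x lphi.
have phi1 x : phi x <= `|x| by apply: phiE; exists 0; rewrite ?addr0 ?subr0.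
have [//||v phiv] := sd_riesz sd (phi := phi).
  exists 1 => x; rewrite mul1r ler_norml phi1 andbT.
  by have := phi1 (- x); rewrite phiN normrN; lra.
have phiM m : M (g + m) -> phi m = 0.
  move=> Mm; apply/eqP; rewrite eq_le; apply/andP; split.
    by apply: phiE; exists m; rewrite ?subrr ?normr0.
  rewrite -oppr_le0 -phiN; apply: phiE; exists (- m); rewrite ?subrr ?normr0//.
  by rewrite -scaleN1r; exact: M0Z.
have : beta z v = beta g v.
  apply: constant_form_fitz_dom_diff Dz => [||a b Aa Bb]; [by exists a0|by exists b0|].
  have := phiM (a - b - g); rewrite addrC subrK phiv (sd_sym sd v).
  rewrite [beta (_ - g) _](formBl sd).
  by move=> h; apply/eqP; rewrite -subr_eq0 h//; apply: GM; exists a => //; exists b.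
have : e <= phi (z - g).
  rewrite phiz; apply: lb_le_inf; first by exists `|z - g - 0|, 0; rewrite ?addr0.
  move=> r [m Mm]; apply: le_trans; apply: le_trans (eM _ Mm) _.
  by rewrite opprD addrA.
by rewrite phiv (sd_sym sd v) (formBl sd); lra.
Qed.

End fitz_dom_diff.

(** Translating [A] by [w] translates its Fitzpatrick domain, so that [w] may be
    taken to be [0]; the direction [Y] of [aff D] is then absorbed by [D]. *)
Theorem intrinsic_core_fitz_dom_diff {R : realType} {Z : normedModType R}
    {beta : Z -> Z -> R} (sd : self_dual beta) (A B : set Z) :
  maximal_positive beta A -> maximal_positive (opp_form beta) B ->
  let D := minkowski_diff (fitz_dom beta A) (fitz_dom (opp_form beta) B) in
  closed (aff_hull D) -> intrinsic_core D `<=` minkowski_diff A B.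
Proof.
move=> mA mB D cD w [Dw iw].
pose A' := [set z | A (z + w)].
have mA' : maximal_positive beta A' := maximal_positive_shift w mA.
pose D' := minkowski_diff (fitz_dom beta A') (fitz_dom (opp_form beta) B).
have D'P u : D' u <-> D (u + w).
  split=> [[z1 /fitz_dom_shift z1A [z2 z2B <-]]|[z1 z1A [z2 z2B zw]]].
    by exists (z1 + w); [exact: z1A|exists z2 => //; rewrite addrAC].
  exists (z1 - w); first by apply/(fitz_dom_shift sd); rewrite subrK.
  by exists z2 => //; rewrite addrAC zw addrK.
pose Y : set Z := [set x | aff_hull D (x + w)].
have affw : aff_hull D w by exact: sub_aff_hull.
have cY : closed Y.
  apply/closed_normP => x xY; apply: ((closed_normP (aff_hull D)).1 cD (x + w)) => e e0.
  have [s Ys xs] := xY e e0; exists (s + w) => //.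
  by rewrite opprD addrACA subrr addr0.
have Y0 : Y 0 by rewrite /Y /= add0r.
have YZ t u : Y u -> Y (t *: u).
  move=> Yu; rewrite /Y /=.
  have -> : t *: u + w = t *: (u + w) + (1 - t) *: w.
    by rewrite scalerDr scalerBl scale1r -addrA subrKC.
  exact: affine_aff_hull.
have YD u v : Y u -> Y v -> Y (u + v).
  move=> Yu Yv; rewrite /Y /=.
  have -> : u + v + w = (u + w) + (v + w) - w by rewrite addrACA addrA addrK.
  exact: (affine_set_parallelogram (@affine_aff_hull _ _ D)).
have D'Y u : D' u -> Y u by move=> /D'P Du; exact: (sub_aff_hull Du).
have Yabs u : Y u -> exists2 d : R, 0 < d & D' (d *: u).
  move=> Yu; have [|d d0 dD] := iw u.
    by rewrite -[u](addrK w); exact: aff_hull_minkowski_diff.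
  by exists d => //; apply/D'P; rewrite addrC; apply: dD; rewrite lexx ltW.
have [m [rho rho0 mY]] := sublevel_diff_absorbs sd cY Y0 YZ YD Yabs.
have K0 : 0 <= 2 * m%:R / rho by rewrite divr_ge0 ?mulr_ge0// ltW.
have [||v hv] := separating_vector sd mA' mB K0.
- have [|z1 [z2 [z12 z1m z2m _]]] := mY 0 Y0; first by rewrite normr0 ltW.
  exists z1, m%:R, m%:R; split=> //; suff -> : z1 = z2 by [].
  by apply/eqP; rewrite -subr_eq0 -z12.
- exact: fitz_sum_lipschitz D'Y rho0 mY.
have [A'v Bv] := maximal_positive_meet sd mA' mB hv.
by exists (v + w); [exact: A'v|exists v => //; rewrite addrC addKr].
Qed.

(** * The theorem for maximal positive sets *)
(** Since [D] has the affine hull of [conv G], its intrinsic core contains that of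
    [conv G] and is contained in [G]; hence the sandwich for every set between [G]
    and [D]. *)
Theorem ic_between {R : realType} {Z : normedModType R}
    {beta : Z -> Z -> R} (sd : self_dual beta) (A B : set Z) :
  maximal_positive beta A -> maximal_positive (opp_form beta) B ->
  let G := minkowski_diff A B in
  let D := minkowski_diff (fitz_dom beta A) (fitz_dom (opp_form beta) B) in
  ic (conv_hull G) !=set0 ->
  G `<=` conv_hull G /\ conv_hull G `<=` D /\
  forall S, G `<=` S -> S `<=` D -> ic S = ic D.
Proof.
move=> mA mB G D; rewrite {1}/ic; case: ifPn => [/asboolP cC [c0 c0i]|_ []//].
have sd' := self_dual_opp sd.
have GC : G `<=` conv_hull G by exact: sub_gen_smallest.
have GD : G `<=` D.
  move=> _ [a Aa [b Bb <-]]; exists a; first exact: (sub_fitz_dom sd mA).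
  by exists b => //; exact: (sub_fitz_dom sd' mB).
have sD : segment_closed D by exact: fitz_dom_diff_segment_closed.
have CD : conv_hull G `<=` D by apply: smallest_sub => //; exact/convex_setP.
split=> //; split=> // S GS SD.
have G0 : G !=set0.
  have [c Cc] : conv_hull G !=set0 by exists c0; case: c0i.
  apply: contrapT => noG; apply: (Cc set0); split => // z Gz.
  by apply: noG; exists z.
have DaffC : D `<=` aff_hull (conv_hull G).
  apply: (fitz_dom_diff_sub_affine sd mA mB) => //; first exact: affine_aff_hull.
  exact: subset_trans GC (@sub_aff_hull _ _ _).
have affD : aff_hull D = aff_hull (conv_hull G).
  apply/seteqP; split; last exact: aff_hullS.
  by apply: aff_hull_min => //; exact: affine_aff_hull.
have iDG : intrinsic_core D `<=` G.
  by apply: (intrinsic_core_fitz_dom_diff sd mA mB); rewrite affD.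
apply: ic_sandwich => //; last exact: subset_trans iDG GS.
by exists c0; exact: intrinsic_coreS c0i.
Qed.

Section duality_pairing.
Context {R : realType} {X : normedModType R}.
Implicit Types (z w : X * dual X).

Lemma dual_apply_le (V : normedModType R) (f : dual V) (x : V) :
  `|f x| <= `|f| * `|x|.
Proof.
have [->|x0] := eqVneq x 0; first by rewrite linear0 !normr0 mulr0.
have nx0 : 0 < `|x| by rewrite normr_gt0.
rewrite -ler_pdivrMr// mulrC.
have := dual_norm_ub f (x := `|x|^-1 *: x).
rewrite normrZ gtr0_norm ?invr_gt0// mulVf ?gt_eqF// => /(_ (lexx _)).
by rewrite linearZ /= normrM gtr0_norm ?invr_gt0.
Qed.

(** Existence is stated as an equality of functions, so that the functional can be
    traded for an element of the dual by rewriting. *)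
Lemma dual_of_bounded (V : normedModType R) (f : V -> R) (C : R) :
  linear_form f -> (forall x, `|f x| <= C * `|x|) -> exists g : dual V, f = g.
Proof.
move=> lf fC.
have fB x y : f (x - y) = f x - f y.
  have := lf (-1) y x; rewrite scaleN1r addrC; lra.
have C1 : 0 < `|C| + 1 by rewrite ltr_wpDl.
have cf : continuous (f : V -> R^o).
  move=> x; apply/cvgrPdist_le => e e0; near=> y.
  rewrite -fB; apply: le_trans (fC _) _.
  have xy : `|x - y| <= e / (`|C| + 1).
    by near: y; apply: cvgr_dist_le; [exact: cvg_id|exact: divr_gt0].
  rewrite ler_pdivlMr// mulrC in xy; apply: le_trans xy.
  by rewrite ler_wpM2r//; have := ler_norm C; lra.
have fd : (f : V -> R^o) \in @dual_pred R V.
  by apply/mem_set; split=> // a x y; exact: lf.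
by exists (Dual fd).
Unshelve. all: by end_near. Qed.

Definition dual_form z w : R := pairing z.1 w.2 + pairing w.1 z.2.

(** A continuous functional on the product is the sum of its restrictions to the
    two factors: the first is an element of the dual, the second one of the bidual,
    hence of [X].  The norm condition is the definition of the dual norm on the
    second component and the Hahn-Banach theorem on the first one. *)
Lemma self_dual_form : reflexive_space X -> self_dual dual_form.
Proof.
move=> hX; split.
- by move=> z w; rewrite /dual_form addrC.
- move=> w a x y; rewrite /dual_form /pairing /= linearP /=.
  transitivity (a * w.2 x.1 + w.2 y.1 + (a * x.2 w.1 + y.2 w.1)); first by [].
  by rewrite mulrDr addrACA.
- move=> z w; apply: le_trans (ler_normD _ _) _.
  have n1 (u : X * dual X) : `|u.1| <= `|u| by rewrite prod_normE le_max lexx.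
  have n2 (u : X * dual X) : `|u.2| <= `|u| by rewrite prod_normE le_max lexx orbT.
  have h1 : `|pairing z.1 w.2| <= `|z| * `|w|.
    by apply: le_trans (dual_apply_le _ _) _; rewrite mulrC ler_pM.
  have h2 : `|pairing w.1 z.2| <= `|z| * `|w|.
    by apply: le_trans (dual_apply_le _ _) _; rewrite ler_pM.
  by rewrite -mulrA; lra.
- move=> phi lphi [C phiC].
  have [f fP] : exists f : dual X, (fun x => phi (x, 0)) = f.
    apply: (@dual_of_bounded _ _ C) => [a x y|x].
      by rewrite -lphi; congr phi; congr pair; rewrite /= scaler0 addr0.
    by apply: le_trans (phiC _) _; rewrite prod_normE /= normr0 max_l.
  have [g gP] : exists g : dual (dual X), (fun xs => phi (0, xs)) = g.
    apply: (@dual_of_bounded _ _ C) => [a x y|x].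
      by rewrite -lphi; congr phi; congr pair; rewrite /= scaler0 addr0.
    by apply: le_trans (phiC _) _; rewrite prod_normE /= normr0 max_r.
  have [x0 x0P] := hX g; exists (x0, f); apply/funext => -[x xs].
  rewrite /dual_form /= -x0P -gP /pairing -fP.
  have := lphi 1 (0, xs) (x, 0); rewrite mul1r => <-.
  by congr phi; congr pair; rewrite /= ?scale1r ?add0r ?addr0 ?scaler0 ?add0r.
- move=> z C C0 zC; rewrite prod_normE ge_max; apply/andP; split; last first.
    apply: dual_norm_le => x x1; have := zC (x, 0).
    rewrite /dual_form /pairing /= [X in `|X + _|](_ : _ = 0) // add0r => h.
    apply: le_trans h _; rewrite prod_normE /= normr0 max_l//.
    by rewrite -[leRHS]mulr1 ler_wpM2l.
  have ns : sublinear (fun x : X => `|x|).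
    split; first exact: ler_normD.
    by move=> t x t0; rewrite normrZ gtr0_norm.
  have [phi [lphi phi1 phiz]] := hahn_banach z.1 ns.
  have phin x : `|phi x| <= `|x|.
    by rewrite ler_norml phi1 andbT; have := phi1 (- x);
       rewrite linear_formN// normrN; lra.
  have [f fP] : exists f : dual X, phi = f.
    by apply: (@dual_of_bounded _ _ 1) => // x; rewrite mul1r.
  have f1 : `|f| <= 1.
    by apply: dual_norm_le => x x1; rewrite -fP (le_trans (phin x)).
  have := zC (0, f); rewrite /dual_form /pairing /= linear0 addr0 -fP phiz.
  rewrite normr_id => h; apply: le_trans h _; rewrite prod_normE /= normr0 max_r//.
  by rewrite -[leRHS]mulr1 ler_wpM2l.
Qed.

Lemma qform_dual_form z : qform dual_form z = pairing z.1 z.2.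
Proof. by rewrite /qform /dual_form; lra. Qed.

End duality_pairing.

(** * Graphs of monotone operators and representatives *)
Section monotone_operators.
Context {R : realType} {X : normedModType R}.
Implicit Types (A B : operator X) (z w : X * dual X) (F : X * dual X -> \bar R).

Local Notation beta := (@dual_form R X).

(** Adjoining a point related to the whole graph gives a monotone extension. *)
Lemma maximal_positive_gra A : maximal_monotone A ->
  maximal_positive beta (gra A).
Proof.
move=> [mA maxA]; split=> [a b Aa Ab|z zA].
  by rewrite qform_dual_form; exact: mA.
pose B : operator X := fun x xs => A x xs \/ (x, xs) = z.
have eta (u : X * dual X) : (u.1, u.2) = u by case: u.
have <- : gra B = gra A.
  apply: maxA; last by move=> u Au; left.
  have pairingC u : pairing (u.1 - z.1) (u.2 - z.2) = pairing (z.1 - u.1) (z.2 - u.2).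
    rewrite -(opprB z.1) -(opprB z.2) /pairing linearN.
    by rewrite -[RHS]opprK.
  move=> u v [Au|]; rewrite ?eta.
    move=> [Av|]; first exact: mA.
    by rewrite eta => ->; rewrite pairingC; have := zA u Au; rewrite qform_dual_form.
  move=> -> [Av|].
    by have := zA v Av; rewrite qform_dual_form.
  by rewrite eta => ->; rewrite !subrr /pairing linear0.
by right; exact: eta.
Qed.

(** [flip] exchanges [gra B] and [gra (- B)], and changes the sign of the form. *)
Definition flip z : X * dual X := (z.1, - z.2).

Lemma gra_opp_operator B z : gra (opp_operator B) z <-> gra B (flip z).
Proof.
rewrite /gra /opp_operator /flip /=; split=> [[xs Bxs <-]|Bz]; first by rewrite opprK.
by exists (- z.2) => //; rewrite opprK.
Qed.

Lemma flipK z : flip (flip z) = z.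
Proof. by case: z => x xs; rewrite /flip /= opprK. Qed.

Lemma flipB z w : flip (z - w) = flip z - flip w.
Proof. by rewrite /flip /= opprD. Qed.

Lemma dual_form_flip z w : beta (flip z) (flip w) = opp_form beta z w.
Proof. by rewrite /opp_form /dual_form /flip /pairing /= -opprD. Qed.

Lemma qform_flip z : qform beta (flip z) = qform (opp_form beta) z.
Proof. by rewrite /qform dual_form_flip. Qed.

Lemma maximal_positive_gra_opp B : maximal_monotone B ->
  maximal_positive (opp_form beta) (gra (opp_operator B)).
Proof.
move=> /maximal_positive_gra[pB mB]; split=> [a b|z zB].
  move=> /gra_opp_operator Ba /gra_opp_operator Bb.
  by rewrite -qform_flip flipB; exact: pB.
apply/gra_opp_operator; apply: mB => a Ba.
rewrite -[a]flipK -flipB qform_flip; apply: zB.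
by apply/gra_opp_operator; rewrite flipK.
Qed.

Lemma fitz_dom_gra_opp B z :
  fitz_dom (opp_form beta) (gra (opp_operator B)) z <->
  fitz_dom beta (gra B) (flip z).
Proof.
split=> -[r zr]; exists r => a Ba.
  rewrite -[a]flipK dual_form_flip qform_flip; apply: zr.
  by apply/gra_opp_operator; rewrite flipK.
rewrite -dual_form_flip -qform_flip; apply: zr.
exact/gra_opp_operator.
Qed.

Lemma edom_fitzpatrick A : edom (fitzpatrick A) = fitz_dom beta (gra A).
Proof.
have fE z a : beta z a - qform beta a =
    pairing z.1 a.2 + pairing a.1 z.2 - pairing a.1 a.2.
  by rewrite qform_dual_form.
apply/seteqP; split=> z /=.
  move=> zoo; have [r zr] : exists r : R, (fitzpatrick A z <= r%:E)%E.
    move: zoo; rewrite /edom /=; case: (fitzpatrick A z) => [r| |] // _.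
      by exists r.
    by exists 0; exact: leNye.
  exists r => a Aa; rewrite fE -lee_fin; apply: le_trans zr.
  by apply: ereal_sup_ubound; exists a.
move=> [r zr]; apply: (@le_lt_trans _ _ r%:E); last exact: ltry.
apply: ge_ereal_sup => _ [a Aa <-]; rewrite lee_fin -fE; exact: zr.
Qed.

Lemma edom_hat F : edom (hat F) = [set z | edom F (flip z)].
Proof. by []. Qed.

Lemma edom_hat_fitzpatrick B : edom (hat (fitzpatrick B)) =
  fitz_dom (opp_form beta) (gra (opp_operator B)).
Proof.
apply/seteqP; split=> z; rewrite edom_hat edom_fitzpatrick /=;
  by move=> h; apply/fitz_dom_gra_opp.
Qed.

Lemma gra_sub_edom A F : representative A F -> gra A `<=` edom F.
Proof. by move=> [_ _ _ _ ->] z /= Fz; rewrite /edom /= Fz ltry. Qed.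

(** A representative dominates the Fitzpatrick function.  On the segment from [a]
    in the graph to [z], convexity bounds [q] by the chord of [F]:
    [q (t *: z + (1 - t) *: a) <= t * F z + (1 - t) * q a].  Expanding [q], dividing
    by [t] and letting [t] tend to [0] leaves [beta z a - q a <= F z]. *)
Lemma edom_sub_fitz_dom (sd : self_dual beta) A F :
  representative A F -> edom F `<=` fitz_dom beta (gra A).
Proof.
move=> [Fny _ cF Fge Agra] z Fz; pose r := fine (F z).
have Fr : F z = r%:E by rewrite fineK// fin_numElt Fny.
exists r => a Aa; have Fa : F a = (qform beta a)%:E.
  by move: Aa; rewrite Agra qform_dual_form.
have Fq u : ((qform beta u)%:E <= F u)%E.
  by rewrite qform_dual_form; case: u => x xs; have [] := Fge x xs.
have key t : 0 < t < 1 ->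
    beta z a - qform beta a + t * (qform beta z - beta z a + qform beta a) <= r.
  move=> t01; have /andP[t0 t1] := t01.
  have := le_trans (Fq _) (cF z a t t01).
  rewrite Fr Fa -!EFinM -EFinD lee_fin (qformD sd) !(qformZ sd).
  rewrite (formZl sd) (formZr sd) => h; rewrite -(ler_pM2l t0).
  by move: (qform beta z) (qform beta a) (beta z a) h => ? ? ?; lra.
apply/ler_addgt0Pr => e e0.
set k := qform beta z - beta z a + qform beta a in key.
have d0 : 0 < e + `|k| + 1 by have := normr_ge0 k; lra.
pose t := e / (e + `|k| + 1).
have t01 : 0 < t < 1.
  by rewrite divr_gt0//= ltr_pdivrMr// mul1r; have := normr_ge0 k; lra.
have tk : t * `|k| <= e by rewrite /t mulrAC ler_pdivrMr// ler_pM2l//; lra.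
have t0 : 0 <= t by have /andP[/ltW] := t01.
have := ler_wpM2l t0 (ler_norm (- k)); rewrite normrN mulrN.
by have := key t t01; lra.
Qed.

End monotone_operators.

Theorem theorem2p7 (R : realType) (X : completeNormedModType R)
    (hX : reflexive_space X) (A B : operator X)
    (hA : maximal_monotone A) (hB : maximal_monotone B)
    (hne : ic (conv_hull (minkowski_diff (gra A) (gra (opp_operator B))))
             !=set0) :
  (ic (minkowski_diff (gra A) (gra (opp_operator B))) =
     ic (conv_hull (minkowski_diff (gra A) (gra (opp_operator B)))) /\
   ic (conv_hull (minkowski_diff (gra A) (gra (opp_operator B)))) =
     ic (minkowski_diff (edom (fitzpatrick A)) (edom (hat (fitzpatrick B))))) /\
  (forall F1 F2 : X * dual X -> \bar R,
     representative A F1 -> representative B F2 ->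
     ic (minkowski_diff (edom F1) (edom (hat F2))) =
       ic (conv_hull (minkowski_diff (gra A) (gra (opp_operator B)))) /\
     ic (conv_hull (minkowski_diff (gra A) (gra (opp_operator B)))) =
       ic (minkowski_diff (edom (fitzpatrick A))
                          (edom (hat (fitzpatrick B))))).
Proof.
have sd := self_dual_form hX.
have mA := maximal_positive_gra hA.
have mB := maximal_positive_gra_opp hB.
have [GC [CD icE]] := ic_between sd mA mB hne.
rewrite edom_fitzpatrick edom_hat_fitzpatrick.
rewrite (icE _ GC CD); split=> [|F1 F2 repF1 repF2].
  by split=> //; apply: icE => //; exact: subset_trans CD.
split=> //; apply: icE => _ [a Aa [b Bb <-]]; exists a.
- exact: gra_sub_edom repF1 _ Aa.
- exists b => //; rewrite edom_hat; apply: (gra_sub_edom repF2).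
  exact/gra_opp_operator.
- exact: edom_sub_fitz_dom repF1 _ Aa.
- exists b => //; apply/fitz_dom_gra_opp; exact: (edom_sub_fitz_dom sd repF2).
Qed.
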